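(* Let $E,J,R\in\mathbb{C}^{n,n}$ and $B\in\mathbb{C}^{n,m}$ with $E=E^H\ge 0$, $R=R^H\ge 0$, $J=-J^H$ and $B$ of full column rank (the coefficients of a port-Hamiltonian descriptor system $E\dot x=(J-R)x+Bu$, $y=B^Hx$). Then there exist matrices $F_S=-F_S^H\in\mathbb{C}^{m,m}$ and $F_H=F_H^H\in\mathbb{C}^{m,m}$ such that the pair $(E,\;J+BF_SB^H-(R+BF_HB^H))$ is regular and $R+BF_HB^H\ge 0$ if and only if $$\operatorname{rank}\begin{bmatrix}E & J-R & B\end{bmatrix}=n.$$
   Context: $\mathbb{C}^{p,q}$ denotes the complex $p\times q$ matrices. For a Hermitian matrix $M$, $M\ge 0$ ($M>0$) means positive semidefinite (positive definite). A pair $(E,A)$ of square matrices (identified with the pencil $\lambda E-A$) is regular if $\det(\lambda_0E-A)\ne 0$ for some $\lambda_0\in\mathbb{C}$. *)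

(* Defs.v *)
From mathcomp Require Import all_boot all_order all_algebra.

Set Implicit Arguments.
Unset Strict Implicit.
Unset Printing Implicit Defensive.

Import Order.TTheory GRing.Theory Num.Theory.
Local Open Scope ring_scope.
Local Open Scope sesquilinear_scope.

(* In a numClosedFieldType, 0 <= z means that z is real and nonnegative. *)
Definition psdmx (C : numClosedFieldType) (n : nat) (M : 'M[C]_n) : Prop :=
  M = M ^t* /\ forall x : 'cV[C]_n, 0 <= (x ^t* *m M *m x) 0 0.

Definition regular_pair (C : numClosedFieldType) (n : nat) (E A : 'M[C]_n) :
  Prop := exists lambda0 : C, \det (lambda0 *: E - A) != 0.

(* Main.v *)
(** With the output feedback F_S = 0, F_H = I, the point lambda0 = 1 already
    works: if a row v satisfies v (E + D + B B^H - J) = 0, then the real part of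
    v (E + D + B B^H - J) v^H = 0 is a sum of nonnegative terms, so v is
    annihilated by E, D and B, hence also by J, and the rank condition gives
    v = 0.  Conversely every left null vector of [E, J - D, B] is a left null
    vector of each closed-loop matrix lambda0 E - A. *)
Require Import Defs.
From mathcomp Require Import all_boot all_order all_algebra.
From mathcomp Require Import reals complex ring.

Set Implicit Arguments.
Unset Strict Implicit.
Unset Printing Implicit Defensive.

Import Order.TTheory GRing.Theory Num.Theory.
Local Open Scope ring_scope.
Local Open Scope sesquilinear_scope.

(** Full row rank means trivial left kernel, and a row vector acts on the three blocks
    separately. *)
Lemma rank_row3P (K : fieldType) n m1 m2 m3 (X : 'M[K]_(n, m1))
    (Y : 'M[K]_(n, m2)) (Z : 'M[K]_(n, m3)) :
  \rank (row_mx X (row_mx Y Z)) = n <->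
  forall v : 'rV_n, v *m X = 0 -> v *m Y = 0 -> v *m Z = 0 -> v = 0.
Proof.
split=> [rk v vX vY vZ|inj].
  have free : row_free (row_mx X (row_mx Y Z)) by apply/eqP.
  by apply/eqP; rewrite -(mulmx_free_eq0 _ free) !mul_mx_row vX vY vZ !row_mx0.
apply/eqP/inj_row_free => v; rewrite !mul_mx_row -row_mx0 => /eq_row_mx[vX].
by rewrite -row_mx0 => /eq_row_mx[vY vZ]; apply: inj.
Qed.

Section PositiveSemidefinite.
Variable C : numClosedFieldType.

Lemma trmxC_mul m n p (A : 'M[C]_(m, n)) (B : 'M_(n, p)) :
  (A *m B) ^t* = B ^t* *m A ^t*.
Proof. by rewrite trmx_mul map_mxM. Qed.

Lemma trmxCD m n (A B : 'M[C]_(m, n)) : (A + B) ^t* = A ^t* + B ^t*.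
Proof. by rewrite linearD map_mxD. Qed.

Lemma gram_ge0 n (v : 'rV[C]_n) : 0 <= (v *m v ^t*) 0 0.
Proof. by rewrite mxE sumr_ge0 // => i _; rewrite !mxE mul_conjC_ge0. Qed.

Lemma gram_eq0 n (v : 'rV[C]_n) : (v *m v ^t*) 0 0 = 0 -> v = 0.
Proof.
rewrite mxE => /eqP; rewrite psumr_eq0 => [/allP v0|i _]; last first.
  by rewrite !mxE mul_conjC_ge0.
apply/rowP => i; apply/eqP; move: (v0 i (mem_index_enum _)).
by rewrite !mxE mul_conjC_eq0.
Qed.

Lemma psdmx_rowP n (M : 'M[C]_n) (v : 'rV[C]_n) :
  psdmx M -> 0 <= (v *m M *m v ^t*) 0 0.
Proof. by case=> _ /(_ (v ^t*)); rewrite trmxCK. Qed.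

Lemma psdmxD n (M N : 'M[C]_n) : psdmx M -> psdmx N -> psdmx (M + N).
Proof.
move=> [hM pM] [hN pN]; split; first by rewrite trmxCD -hM -hN.
by move=> x; rewrite mulmxDr mulmxDl mxE addr_ge0.
Qed.

Lemma psdmx_gram n m (B : 'M[C]_(n, m)) : psdmx (B *m B ^t*).
Proof.
split; first by rewrite trmxC_mul trmxCK.
move=> x; rewrite mulmxA -mulmxA.
by rewrite -[X in _ *m (_ *m X)]trmxCK -trmxC_mul gram_ge0.
Qed.

(** With [w = v M], moving from [v] along [-w] changes the form at first order by [-2 t (w w^H)].
    Since the form starts at 0 and stays nonnegative, [w w^H] must vanish. *)
Lemma psdmx_ker n (M : 'M[C]_n) (v : 'rV[C]_n) :
  psdmx M -> (v *m M *m v ^t*) 0 0 = 0 -> v *m M = 0.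
Proof.
move=> pM v0; have [hM _] := pM; apply: gram_eq0.
set w := v *m M; set a := (w *m w ^t*) 0 0.
pose c := (w *m M *m w ^t*) 0 0.
have a0 : 0 <= a by exact: gram_ge0.
have c0 : 0 <= c by exact: psdmx_rowP.
have wE : w ^t* = M *m v ^t* by rewrite trmxC_mul -hM.
(* Minimising the form along the line [v - t w] for real [t]. *)
have quad t : t^* = t -> 0 <= - (t * a *+ 2) + t ^+ 2 * c.
  move=> tr; have := psdmx_rowP (v - t *: w) pM.
  suff -> : ((v - t *: w) *m M *m (v - t *: w) ^t*) 0 0
    = - (t * a *+ 2) + t ^+ 2 * c by [].
  have -> : (v - t *: w) ^t* = v ^t* - t *: w ^t*.
    by apply/colP => i; rewrite !mxE rmorphB rmorphM /= tr.
  rewrite mulmxBr !mulmxBl -!scalemxAl -!scalemxAr -/w.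
  rewrite -[w *m M *m v ^t*]mulmxA -wE.
  move: v0; rewrite /a /c.
  move: (v *m M *m v ^t*) (w *m w ^t*) (w *m M *m w ^t*) => X Y Z X0.
  by rewrite !mxE X0; ring.
have c2 : 0 < c + 1 by rewrite ltr_wpDl.
(* The exact minimiser would be [a / c], but [c] may be 0. With [c + 1] the bound of [quad] becomes
   [0 <= - t^2 (c + 2)], which forces [t = 0] and hence [a = 0]. *)
pose t := a / (c + 1).
have t0 : 0 <= t by rewrite divr_ge0 // ltW.
have := quad t (CrealP (ger0_real t0)).
have aE : a = t * (c + 1) by rewrite /t divfK ?gt_eqF.
rewrite {1}aE (_ : - _ + _ = - (t ^+ 2 * (c + 2))); last by ring.
rewrite oppr_ge0 pmulr_lle0 ?ltr_wpDl //.
move=> t2; have /eqP : t ^+ 2 == 0 by rewrite eq_le t2 exprn_ge0.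
by move/eqP; rewrite sqrf_eq0 => /eqP t00; rewrite aE t00 mul0r.
Qed.

Lemma skew_quad n (J : 'M[C]_n) (v : 'rV[C]_n) :
  J = - J ^t* -> ((v *m J *m v ^t*) 0 0)^* = - (v *m J *m v ^t*) 0 0.
Proof.
(* For a 1 x 1 matrix, conjugating the entry is taking the conjugate transpose. *)
move=> hJ; have -> : ((v *m J *m v ^t*) 0 0)^* = ((v *m J *m v ^t*) ^t*) 0 0.
  by rewrite [RHS]mxE [in RHS]mxE.
have JE : J ^t* = - J by rewrite {2}hJ opprK.
by rewrite !trmxC_mul trmxCK JE mulNmx mulmxN mxE mulmxA.
Qed.

(** The number [v P v^H = v J v^H] is real because [P] is semidefinite and purely imaginary because
    [J] is skew-Hermitian, so it is 0 and [psdmx_ker] applies. *)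
Lemma psd_skew_ker n (P J : 'M[C]_n) (v : 'rV[C]_n) :
  psdmx P -> J = - J ^t* -> v *m (P - J) = 0 -> v *m P = 0 /\ v *m J = 0.
Proof.
move=> pP hJ /eqP; rewrite mulmxBr subr_eq0 => /eqP PJ.
suff vP : v *m P = 0 by rewrite -PJ.
apply: psdmx_ker => //; have ge0 := psdmx_rowP v pP.
have := skew_quad v hJ; rewrite -PJ (CrealP (ger0_real ge0)).
by move/eqP; rewrite -addr_eq0 -mulr2n mulrn_eq0 /= => /eqP.
Qed.

(** The two quadratic forms at [v] are nonnegative with sum 0, so each is 0. *)
Lemma psdmxD_ker n (M N : 'M[C]_n) (v : 'rV[C]_n) :
  psdmx M -> psdmx N -> v *m (M + N) = 0 -> v *m M = 0 /\ v *m N = 0.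
Proof.
move=> pM pN vMN; have /eqP : (v *m (M + N) *m v ^t*) 0 0 = 0.
  by rewrite vMN mul0mx mxE.
rewrite mulmxDr mulmxDl mxE paddr_eq0 ?psdmx_rowP // => /andP[/eqP vM /eqP vN].
by split; apply: psdmx_ker.
Qed.

Lemma mul_gram_eq0 n m (B : 'M[C]_(n, m)) (v : 'rV[C]_n) :
  v *m (B *m B ^t*) = 0 -> v *m B = 0.
Proof.
by move=> vB; apply: gram_eq0; rewrite trmxC_mul mulmxA -(mulmxA v) vB mul0mx mxE.
Qed.

End PositiveSemidefinite.

Theorem theorem6 (R : realType) (n m : nat)
  (E J D : 'M[R[i]]_n) (B : 'M[R[i]]_(n, m))
  (hE : psdmx E) (hD : psdmx D) (hJ : J = - J ^t*) (hB : \rank B = m) :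
  (exists FS FH : 'M[R[i]]_m,
      [/\ FS = - FS ^t*,
          FH = FH ^t*,
          regular_pair E (J + B *m FS *m B ^t* - (D + B *m FH *m B ^t*)) &
          psdmx (D + B *m FH *m B ^t*)])
  <-> \rank (row_mx E (row_mx (J - D) B)) = n.
Proof.
split=> [[FS [FH [_ _ [l det_neq0] _]]]|/rank_row3P inj].
  apply/rank_row3P => v vE vJD vB; apply/eqP; apply: contraNT det_neq0 => v0.
  apply/det0P; exists v => //.
  have vJ : v *m J = v *m D by apply/eqP; rewrite -subr_eq0 -mulmxBr vJD.
  (* Both feedback terms start with [B] on the left, so [v B = 0] removes them for any [FS] and
     [FH]. *)
  rewrite mulmxBr -scalemxAr vE scaler0 mulmxBr !mulmxDr !mulmxA vB !mul0mx.
  by rewrite !addr0 vJ subrr subr0.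
exists 0, 1%:M.
have pBB := psdmx_gram B.
rewrite mulmx0 mul0mx addr0 mulmx1; split.
- by rewrite trmx0 map_mx0 oppr0.
- by rewrite trmx1 map_mx1.
(* The pencil at 1 becomes [E + (D + B B^H) - J], semidefinite minus skew-Hermitian, as
   [psd_skew_ker] requires. *)
- exists 1; rewrite scale1r opprB addrA.
  apply/det0P => -[v v0 vK]; case/eqP: v0.
  have [vP vJ] := psd_skew_ker (psdmxD hE (psdmxD hD pBB)) hJ vK.
  have [vE vDB] := psdmxD_ker hE (psdmxD hD pBB) vP.
  have [vD vBB] := psdmxD_ker hD pBB vDB.
  apply: inj => //; last exact: mul_gram_eq0.
  by rewrite mulmxBr vJ vD subrr.
- exact: psdmxD.
Qed.
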